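(* Assume that there are $\sigma_0,h_0,T_0>0$ and positive constants $c_1,c_2,c_3,c_4,c_\lambda$, independent of $\sigma,T,h$, such that for all $\sigma\in(0,\sigma_0]$, $T\ge T_0$, $h\in(0,h_0]$, with the notation of the context: 1. (convergence to equilibrium) $\left|\frac{\partial F}{\partial\theta}(\sigma,T)-\Pi'(\sigma)\right|\le c_2\,e^{-\lambda^*(\sigma)T}$, where the rate is proportional to $\sigma^2$: $\lambda^*(\sigma)=c_\lambda\sigma^2$; 2. (first order weak convergence from SDE to ODE) $|\Pi'(\sigma)-\pi'|\le c_3\,\sigma$; 3. (variance) $\mathbb V\left[\frac{\partial\breve F}{\partial\theta}(\sigma,T,h)\right]\le c_4\,T/\sigma^2$; 4. (first order weak error of the time discretization) $\left|\mathbb E\left[\frac{\partial\breve F}{\partial\theta}(\sigma,T,h)\right]-\frac{\partial F}{\partial\theta}(\sigma,T)\right|\le c_1\,h$. Then the optimal (minimal) computational cost of the standard Monte Carlo method for approximating the ODE sensitivity $\pi'$ with mean square error $O(\varepsilon^2)$ is $O(\varepsilon^{-9}|\log\varepsilon|^2)$ as $\varepsilon\to0$. That is, there are constants $C,K>0$ and $\varepsilon_0\in(0,1)$ such that for every $\varepsilon\in(0,\varepsilon_0)$ the infimum of the cost $N T/h$ over all choices of $\sigma\in(0,\sigma_0]$, $T\ge T_0$, $h\in(0,h_0]$ and integers $N\ge1$ for which the Monte Carlo estimator satisfies $\mathbb E\big[|\widehat\mu_N-\pi'|^2\big]\le C\varepsilon^2$ is at most $K\varepsilon^{-9}|\lo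g\varepsilon|^2$.
   Context: Setting. Consider the ODE $\mathrm dx_t=f(\theta;x_t)\,\mathrm dt$ in $\mathbb R^m$, with a real parameter $\theta$, and its stochastic version $\mathrm dX_t=f(\theta;X_t)\,\mathrm dt+\sigma\,\mathrm dW_t$ with volatility $\sigma>0$, $W$ an $m$-dimensional standard Brownian motion and fixed initial value $\xi_0$. Let $\varphi:\mathbb R^m\to\mathbb R$ be a differentiable function with polynomial growth. All sensitivities are derivatives with respect to $\theta$ at a fixed parameter value. Notation. - $\pi'\in\mathbb R$ is the sensitivity of the ODE, i.e. the $\theta$-derivative of the expectation of $\varphi$ under the (physical) invariant measure of the ODE. - $\Pi'(\sigma)\in\mathbb R$ is the sensitivity of the SDE with volatility $\sigma$, i.e. the $\theta$-derivative of the expectation of $\varphi$ under the invariant measure of the SDE. - $\frac{\partial F}{\partial\theta}(\sigma,T)\in\mathbb R$ is the $\theta$-derivative of $F=\mathbb E[\varphi(X_T)]$ for the SDE with volatility $\sigma$. - $\frac{\partial\breve F}{\partial\theta}(\sigma,T,h)$ is the (square-integrable) random variable given by the importance-sampling pathwise sensitivity estimator computed from one numerical path on $[0,T]$ with (average) timestep $h$: $$\frac{\partial\breve F}{\partial\theta}=\langle\nabla\varphi(\widehat Y_T),\widehat y_T\rangle+\varphi(\widehat Y_T)\sum_{n}\frac{S}{\sigma}\langle\widehat y_{t_n},W_{t_{n+1}}-W_{t_n}\rangle,$$ where $S>0$ is a fixed constant and $\widehat Y,\widehat y$ are numerical approximations of the solutions of $\mathrm dY_t=f(\theta;Y_t)\,\mathrm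 dt+\sigma\,\mathrm dW_t$, $Y_0=\xi_0$, and $\mathrm dy_t=\big(\partial_\theta f(\theta;Y_t)+(\partial_xf(\theta;Y_t)-S I)y_t\big)\mathrm dt$, $y_0=0$, on a time grid $0=t_0<t_1<\cdots$ ending at $T$. Standard Monte Carlo method. $\widehat\mu_N$ is the average of $N$ independent copies of $\frac{\partial\breve F}{\partial\theta}(\sigma,T,h)$. The computational cost per path is $T/h$ (number of timesteps), so the total cost is $NT/h$. $\mathbb V$ denotes variance. *)

(* Defs.v *)
(* MathComp-Analysis *)
From HB Require Import structures.
From mathcomp Require Import all_boot all_order all_algebra.
From mathcomp Require Import all_classical all_reals all_analysis.

Set Implicit Arguments.
Unset Strict Implicit.
Unset Printing Implicit Defensive.

Import Order.TTheory GRing.Theory Num.Theory.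
Import numFieldNormedType.Exports.

Local Open Scope classical_set_scope.
Local Open Scope ring_scope.

(* R^m with its Borel sigma-algebra *)
Notation borel_rV R m := (g_sigma_algebraType (@open 'rV[R]_m)).

Section euclidean.
Context {R : realType} {m : nat}.
Implicit Types u v : 'rV[R]_m.

Definition inner u v : R := \sum_(i < m) u 0 i * v 0 i.

Definition grad (phi : 'rV[R]_m -> R) (x : 'rV[R]_m) : 'rV[R]_m :=
  \row_(i < m) 'D_(delta_mx 0 i) phi x.

(* The norm of the library on 'rV[R]_m is the max norm; the notion does not
   depend on the choice of the norm. *)
Definition polynomial_growth (phi : 'rV[R]_m -> R) :=
  exists (C : R) (k : nat), forall x, `|phi x| <= C * (1 + `|x| ^+ k).

(* Lebesgue measure is only available in dimension 1; null sets of R^m are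
   described by coverings by boxes of small total volume. *)
Definition lebesgue_null (A : set 'rV[R]_m) :=
  forall e : R, 0 < e -> exists a b : nat -> 'rV[R]_m,
    [/\ forall n i, a n 0 i <= b n 0 i,
        A `<=` \bigcup_n [set x | forall i, a n 0 i <= x 0 i <= b n 0 i] &
        (\sum_(0 <= n <oo) (\prod_(i < m) (b n 0 i - a n 0 i))%:E <= e%:E)%E].

End euclidean.

Section probability_notions.
Context {R : realType}.

Definition mutually_independent d (Omega : measurableType d)
    (P : probability Omega R) (I : choiceType) d' (E : measurableType d')
    (X : I -> Omega -> E) :=
  forall (J : seq I) (A : I -> set E), uniq J -> (forall i, measurable (A i)) ->
    P (\bigcap_(i in [set` J]) X i @^-1` A i) =
    \big[*%E/1%E]_(i <- J) P (X i @^-1` A i).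

(* standard m-dimensional Brownian motion on the time set [0, +oo[; the values
   W t for t < 0 are irrelevant *)
Definition brownian_motion m d (Omega : measurableType d)
    (P : probability Omega R) (W : R -> Omega -> 'rV[R]_m) :=
  [/\ forall t, 0 <= t -> measurable_fun setT (W t : Omega -> borel_rV R m),
      {ae P, forall w, W 0 w = 0 /\ {within `[0, +oo[, continuous (W ^~ w)}},
      forall t : nat -> R, 0 <= t 0%N -> (forall n, t n < t n.+1) ->
        mutually_independent P (fun (k : nat * 'I_m) w =>
          (W (t k.1.+1) w - W (t k.1) w) 0 k.2) &
      forall (s t : R) (i : 'I_m) (A : set R), 0 <= s -> s < t -> measurable A ->
        P ((fun w => (W t w - W s w) 0 i) @^-1` A) =
        normal_prob 0 (Num.sqrt (t - s)) A].

Definition independent_of_process m d (Omega : measurableType d)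
    (P : probability Omega R) (V : Omega -> 'rV[R]_m)
    (W : R -> Omega -> 'rV[R]_m) :=
  forall (J : seq R) (A : set (borel_rV R m)) (B : R -> set (borel_rV R m)),
    uniq J -> {in J, forall t, 0 <= t} ->
    measurable A -> (forall t, measurable (B t)) ->
    P (V @^-1` A `&` \bigcap_(t in [set` J]) W t @^-1` B t) =
    (P (V @^-1` A) * P (\bigcap_(t in [set` J]) W t @^-1` B t))%E.

Definition iid_copies d (Omega : measurableType d) (P : probability Omega R)
    (X : Omega -> R) d' (Omega' : measurableType d')
    (P' : probability Omega' R) (Z : nat -> Omega' -> R) :=
  [/\ forall i, measurable_fun setT (Z i),
      forall i (A : set R), measurable A -> P' (Z i @^-1` A) = P (X @^-1` A) &
      mutually_independent P' Z].

Definition mc_average (Omega : Type) (Z : nat -> Omega -> R) (N : nat)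
    (w : Omega) : R :=
  N%:R^-1 * \sum_(i < N) Z i w.

End probability_notions.

Section dynamics.
Context {R : realType} {m : nat}.
Local Notation leb := (@lebesgue_measure R).

(* x_t = x_0 + \int_0^t g(x_s) ds + z_t for all t >= 0. The noise of the SDE is
   additive, so the SDE is such an equation with z = sigma W for almost every
   path, and the ODE is the case z = 0. *)
Definition integral_solution (g : 'rV[R]_m -> 'rV[R]_m)
    (x z : R -> 'rV[R]_m) :=
  {within `[0, +oo[, continuous x} /\
  forall (t : R) (i : 'I_m), 0 <= t ->
    leb.-integrable `[0, t] (fun s => (g (x s) 0 i)%:E) /\
    x t 0 i = x 0 0 i + \int[leb]_(s in `[0, t]) g (x s) 0 i + z t 0 i.

Definition sde_solution d (Omega : measurableType d) (P : probability Omega R)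
    (g : 'rV[R]_m -> 'rV[R]_m) (sigma : R) (W X : R -> Omega -> 'rV[R]_m) :=
  (forall t, 0 <= t -> measurable_fun setT (X t : Omega -> borel_rV R m)) /\
  {ae P, forall w, integral_solution g (X ^~ w) (fun t => sigma *: W t w)}.

(* invariant measure of the SDE: the law of a stationary solution *)
Definition sde_invariant (g : 'rV[R]_m -> 'rV[R]_m) (sigma : R)
    (mu : probability (borel_rV R m) R) :=
  exists (d : measure_display) (Omega : measurableType d)
      (P : probability Omega R) (W X : R -> Omega -> 'rV[R]_m),
    [/\ brownian_motion P W,
        sde_solution P g sigma W X,
        independent_of_process P (X 0) W &
        forall (t : R) (A : set (borel_rV R m)), 0 <= t -> measurable A ->
          P (X t @^-1` A) = mu A].

Definition ode_flow (g : 'rV[R]_m -> 'rV[R]_m)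
    (Phi : R -> 'rV[R]_m -> 'rV[R]_m) :=
  (forall x, Phi 0 x = x /\ integral_solution g (Phi ^~ x) (fun=> 0)) /\
  (forall t, 0 <= t ->
    measurable_fun setT (Phi t : borel_rV R m -> borel_rV R m)).

(* physical measure of the ODE: an invariant measure that describes the time
   averages along the trajectories from a set of initial values which is not
   Lebesgue-negligible *)
Definition physical_measure (g : 'rV[R]_m -> 'rV[R]_m)
    (nu : probability (borel_rV R m) R) :=
  exists Phi : R -> 'rV[R]_m -> 'rV[R]_m,
    [/\ ode_flow g Phi,
        forall (t : R) (A : set (borel_rV R m)), 0 <= t -> measurable A ->
          nu (Phi t @^-1` A) = nu A &
        ~ lebesgue_null [set x | forall psi : 'rV[R]_m -> R,
            continuous psi -> (exists M, forall y, `|psi y| <= M) ->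
            T^-1 * (\int[leb]_(t in `[0, T]) psi (Phi t x)) @[T --> +oo] -->
            \int[nu]_y psi y]].

(* [D] is the derivative at [theta] of the expectation of [phi] under the
   measure characterized by [Q th] *)
Definition invariant_sensitivity
    (Q : R -> probability (borel_rV R m) R -> Prop)
    (phi : 'rV[R]_m -> R) (theta D : R) :=
  exists mu : R -> probability (borel_rV R m) R,
    (\forall th \near theta,
      [/\ Q th (mu th),
          forall nu, Q th nu -> forall A, measurable A -> nu A = mu th A &
          (mu th).-integrable setT (fun x => (phi x)%:E)]) /\
    is_derive theta 1 (fun th => \int[mu th]_x phi x) D.

(* [n w] is the number of time steps of the path [w], [t w k] its k-th grid
   point, and [Y w k], [y w k] the numerical values at [t w k]; the grid may be
   adaptive, hence random. The accuracy of [Y] and [y], as approximations of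
     dY_t = f(theta; Y_t) dt + sigma dW_t,
     dy_t = (d_theta f(theta; Y_t) + (d_x f(theta; Y_t) - S I) y_t) dt,
   is not part of the definition. *)
Definition pathwise_estimator (Omega : Type) (phi : 'rV[R]_m -> R)
    (S sigma : R) (W : R -> Omega -> 'rV[R]_m) (n : Omega -> nat)
    (t : Omega -> nat -> R) (Y y : Omega -> nat -> 'rV[R]_m) (w : Omega) : R :=
  inner (grad phi (Y w (n w))) (y w (n w)) +
  phi (Y w (n w)) *
    \sum_(k < n w) S / sigma * inner (y w k) (W (t w k.+1) w - W (t w k) w).

End dynamics.

Definition admissible (R : realType) (sigma0 T0 h0 sigma T h : R) :=
  [/\ 0 < sigma <= sigma0, T0 <= T & 0 < h <= h0].

(* Main.v *)
Require Import Defs.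
From HB Require Import structures.
From mathcomp Require Import all_boot all_order all_algebra.
From mathcomp Require Import all_classical all_reals all_analysis.
From mathcomp Require Import measurable_realfun ring lra.

Set Implicit Arguments.
Unset Strict Implicit.
Unset Printing Implicit Defensive.

Import Order.TTheory GRing.Theory Num.Theory.
Import numFieldNormedType.Exports.

Local Open Scope classical_set_scope.
Local Open Scope ring_scope.

(* With sigma = h = eps and T = |log eps| / (clambda eps^2), the exponential in
   the equilibrium bound equals eps, so that the three bias terms are O(eps).
   The variance of one sample is O(T / eps^2); hence N ~ T / eps^4 samples bring
   the variance of the average down to O(eps^2), at the cost
   N T / h ~ T^2 / eps^5 = eps^-9 |log eps|^2 / clambda^2. The averages have
   variance V / N because independent square-integrable variables are
   uncorrelated: their joint law is the product of their laws. *)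

(** * Expectation, variance and integrability are determined by the law *)

Section same_law.
Local Open Scope ereal_scope.
Context d (T : measurableType d) d' (T' : measurableType d') (R : realType).
Variables (P : probability T R) (P' : probability T' R).
Variables (X : {RV P >-> R}) (Y : {RV P' >-> R}).
Hypothesis XY : forall A, measurable A -> P' (Y @^-1` A) = P (X @^-1` A).

Lemma ge0_integral_same_law (g : R -> \bar R) :
  measurable_fun [set: R] g -> (forall x, 0 <= g x) ->
  \int[P']_w g (Y w) = \int[P]_w g (X w).
Proof.
move=> mg g0.
have /= <- := ge0_integral_distribution X mg g0.
have /= <- := ge0_integral_distribution Y mg g0.
by apply: eq_measure_integral => A mA _; exact: XY.
Qed.

(** The integral is by definition the difference of those of the positive and negative parts, and
    each of these depends on the law only. Hence measurability of [g] suffices, without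
    integrability. *)
Lemma expectation_same_law (g : R -> R) : measurable_fun [set: R] g ->
  'E_P'[g \o Y] = 'E_P[g \o X].
Proof.
move=> mg; have mEg : measurable_fun setT (EFin \o g) by exact/measurable_EFinP.
have posnegE d0 (S : measurableType d0) (mu : {measure set S -> \bar R})
    (Z : S -> R) : \int[mu]_w (g (Z w))%:E =
    \int[mu]_w (EFin \o g)^\+ (Z w) - \int[mu]_w (EFin \o g)^\- (Z w).
  rewrite integralE; congr (_ - _); apply: eq_integral => w _.
    by rewrite !funeposE.
  by rewrite !funenegE.
rewrite unlock /= posnegE [RHS]posnegE; congr (_ - _).
- exact: (ge0_integral_same_law (measurable_funepos mEg) (funepos_ge0 _)).
- exact: (ge0_integral_same_law (measurable_funeneg mEg) (funeneg_ge0 _)).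
Qed.

Lemma variance_same_law : 'V_P'[Y] = 'V_P[X].
Proof.
have EYX : 'E_P'[Y] = 'E_P[X] by exact: (@expectation_same_law id).
rewrite /variance covariance.unlock EYX.
(* Once the common mean is a fixed constant, the variance is the expectation of a measurable
   function of the variable. *)
pose c := fine 'E_P[X].
apply: (@expectation_same_law (fun x => ((x - c) * (x - c))%R)).
by apply: measurable_funM; exact: measurable_funB.
Qed.

(** The L^p norm is built from the integral of a nonnegative function of the variable. This will
    make the copies of the estimator square integrable. *)
Lemma Lfun_same_law (p : R) :
  (X : T -> R) \in Lfun P p%:E -> (Y : T' -> R) \in Lfun P' p%:E.
Proof.
rewrite !inE => /andP[_ /[!inE] Xp].
apply/andP; split; first by rewrite inE; apply: measurable_funPT.
rewrite inE /= /finite_norm Lnorm.unlock.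
rewrite (ge0_integral_same_law (g := fun x => `|x%:E| `^ p)).
- by move: Xp; rewrite /= /finite_norm Lnorm.unlock.
- apply/measurable_EFinP => /=.
  apply: (measurableT_comp (measurable_powR p)).
  exact: normr_measurable.
- by move=> x; exact: poweR_ge0.
Qed.

End same_law.

(** * Expectation of a product of independent variables *)

Section independence.
Local Open Scope ereal_scope.
Context d (T : measurableType d) (R : realType) (P : probability T R).

(** By independence the joint law and the product of the laws agree on rectangles, hence everywhere
    by uniqueness of the product measure; Fubini then factors the integral. *)
Lemma expectationM_indep (X Y : {RV P >-> R}) :
    (X : T -> R) \in Lfun P 1 -> (Y : T -> R) \in Lfun P 1 ->
    (X \* Y)%R \in Lfun P 1 ->
    (forall A B, measurable A -> measurable B ->
      P (X @^-1` A `&` Y @^-1` B) = P (X @^-1` A) * P (Y @^-1` B)) ->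
  'E_P[(X \* Y)%R] = 'E_P[X] * 'E_P[Y].
Proof.
move=> X1 Y1 XY1 indep.
have mXY : measurable_fun setT (fun w => (X w, Y w)).
  by apply/measurable_fun_pairP; split; exact: measurable_funPT.
pose Z : {mfun T >-> (R * R)%type} := HB.pack (fun w => (X w, Y w))
  (isMeasurableFun.Build _ _ _ _ _ mXY).
pose m1 := distribution P X; pose m2 := distribution P Y.
pose f (z : R * R) := (z.1 * z.2)%:E.
have mf : measurable_fun setT f.
  by apply/measurable_EFinP; exact: measurable_funM.
have prodE A : measurable A -> (m1 \x m2) A = distribution P Z A.
  by apply: product_measure_unique => B C mB mC; exact: indep.
(* Fubini needs integrability against the product measure; it is read off the joint law, where it
   amounts to integrability of [X \* Y]. *)
have intf : (m1 \x m2).-integrable setT f.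
  have /integrableP[_ fZ] : (distribution P Z).-integrable setT f.
    by apply: integrable_pushforward => //; exact/Lfun1_integrable.
  apply/integrableP; split => //.
  rewrite (eq_measure_integral (distribution P Z)) // => A mA _; exact: prodE.
rewrite unlock.
have <- : \int[distribution P Z]_z f z = \int[P]_w (X w * Y w)%:E.
  by apply: integral_distribution => //; exact/Lfun1_integrable.
rewrite (eq_measure_integral (m1 \x m2)); last first.
  by move=> A mA _; exact/esym/prodE.
rewrite -integral12_prod_meas1//.
have intX : m1.-integrable setT EFin.
  by apply: integrable_pushforward => //; exact/Lfun1_integrable.
have intY : m2.-integrable setT EFin.
  by apply: integrable_pushforward => //; exact/Lfun1_integrable.
have EX : \int[m1]_x x%:E = \int[P]_w (X w)%:E.
  by apply: integral_distribution => //; exact/Lfun1_integrable.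
have EY : \int[m2]_x x%:E = \int[P]_w (Y w)%:E.
  by apply: integral_distribution => //; exact/Lfun1_integrable.
rewrite -EX -EY.
under eq_integral.
  move=> x _; rewrite /fubini_F /f/=; under eq_integral do rewrite EFinM.
  rewrite integralZl//.
  over.
(* The inner integral is finite, so it can leave the outer one as a real scalar. *)
rewrite -(fineK (integrable_fin_num _ intY))//.
by rewrite integralZr.
Qed.

End independence.

(** * Bias, variance and the mean square error of an average *)

Section mean_square_error.
Local Open Scope ereal_scope.
Context d (T : measurableType d) (R : realType) (P : probability T R).

Let Lfun21 (X : T -> R) : X \in Lfun P 2%:E -> X \in Lfun P 1.
Proof. exact: (Lfun_subset12 (fin_num_measure P _ measurableT)). Qed.

Lemma covariance_indep (X Y : {RV P >-> R}) :
    (X : T -> R) \in Lfun P 2%:E -> (Y : T -> R) \in Lfun P 2%:E ->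
    (forall A B, measurable A -> measurable B ->
      P (X @^-1` A `&` Y @^-1` B) = P (X @^-1` A) * P (Y @^-1` B)) ->
  covariance P X Y = 0.
Proof.
move=> X2 Y2 indep.
have X1 := Lfun21 X2; have Y1 := Lfun21 Y2; have XY1 := Lfun2_mul_Lfun1 X2 Y2.
rewrite covarianceE// [X in X - _](expectationM_indep X1 Y1 XY1 indep).
by rewrite subee// fin_numM// expectation_fin_num.
Qed.

Lemma Lfun2_sum (X : nat -> T -> R) n :
  (forall i, X i \in Lfun P 2%:E) -> (\sum_(i < n) X i)%R \in Lfun P 2%:E.
Proof. by move=> X2; rewrite rpred_sum// lee1n. Qed.

Lemma variance_sum_uncorrelated (X : nat -> T -> R) n :
    (forall i, X i \in Lfun P 2%:E) ->
    (forall i j, i != j -> covariance P (X i) (X j) = 0) ->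
  'V_P[(\sum_(i < n) X i)%R] = \sum_(i < n) 'V_P[X i].
Proof.
move=> X2 uncorr; elim: n => [|n IH].
  by rewrite !big_ord0 -(variance_cst P 0).
rewrite !big_ord_recr/= [LHS]varianceD//; last exact: Lfun2_sum.
rewrite IH -[RHS]adde0; congr (_ + _).
(* The index [n] stays fixed while the partial sum grows; [k <= n] keeps every summand index
   different from [n]. *)
suff -> : forall k, (k <= n)%N -> covariance P (\sum_(i < k) X i)%R (X n) = 0.
- by rewrite mule0.
- by [].
elim=> [|k IHk] kn; first by rewrite big_ord0 -[0%R]/(cst 0%R) covariance_cst_l.
rewrite big_ord_recr/= [LHS]covarianceDl//; last exact: Lfun2_sum.
by rewrite IHk 1?ltnW// add0e uncorr// neq_ltn kn.
Qed.

(** Bias-variance decomposition: a shift by [c] leaves the variance unchanged, and the variance of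
    the shifted variable is its second moment minus its squared mean. *)
Lemma expectation_sqrB_cst (X : T -> R) (c : R) : X \in Lfun P 2%:E ->
  'E_P[(fun w => (X w - c) ^+ 2)%R] = 'V_P[X] + ((fine 'E_P[X] - c) ^+ 2)%:E.
Proof.
move=> X2; have X1 := Lfun21 X2.
have Xc2 : (X \- cst c)%R \in Lfun P 2%:E.
  by rewrite rpredB ?lee1n//= => _; exact: Lfun_cst.
rewrite -(varianceB_cst_r c X2) varianceE//.
have -> : 'E_P[(X \- cst c)%R] = (fine 'E_P[X] - c)%:E.
  rewrite expectationB ?Lfun_cst// expectation_cst EFinB fineK//.
  exact: expectation_fin_num.
by rewrite -EFin_expe subeK.
Qed.

End mean_square_error.

(** The copies inherit mean and variance from [X] and are pairwise uncorrelated, so the sum has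
    variance N V, which the squared factor 1/N turns into V/N. *)
Lemma expectation_mc_average_sqrB d (T : measurableType d) d'
    (T' : measurableType d') (R : realType) (P : probability T R)
    (P' : probability T' R) (X : T -> R) (Z : nat -> T' -> R) (N : nat) (c : R) :
    X \in Lfun P 2%:E -> iid_copies P X P' Z -> (0 < N)%N ->
  ('E_P'[fun w => ((mc_average Z N w - c) ^+ 2)%R] =
   (N%:R^-1)%:E * 'V_P[X] + ((fine 'E_P[X] - c) ^+ 2)%:E)%E.
Proof.
move=> X2 [mZ lawZ indepZ] N0.
have mX : measurable_fun setT X by move: X2; rewrite inE => /andP[/[!inE]].
pose X' : {RV P >-> R} := HB.pack X (isMeasurableFun.Build _ _ _ _ X mX).
pose Z' i : {RV P' >-> R} :=
  HB.pack (Z i) (isMeasurableFun.Build _ _ _ _ (Z i) (mZ i)).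
have Z2 i : Z i \in Lfun P' 2%:E.
  by apply: (@Lfun_same_law _ _ _ _ _ _ _ X' (Z' i)) => //; exact: lawZ.
have Z1 i : Z i \in Lfun P' 1.
  exact: (Lfun_subset12 (fin_num_measure P' _ measurableT)).
have EZ i : ('E_P'[Z i] = 'E_P[X])%E.
  by apply: (@expectation_same_law _ _ _ _ _ _ _ X' (Z' i) _ id) => //; exact: lawZ.
have VZ i : ('V_P'[Z i] = 'V_P[X])%E.
  by apply: (@variance_same_law _ _ _ _ _ _ _ X' (Z' i)); exact: lawZ.
have uncorr i j : i != j -> covariance P' (Z i) (Z j) = 0%E.
  move=> ij; apply: (@covariance_indep _ _ _ _ (Z' i) (Z' j) (Z2 i) (Z2 j)).
  move=> A B mA mB.
  (* Mutual independence on the two-element list gives pairwise independence; [i != j] is what makes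
     the list duplicate-free. *)
  have := indepZ [:: i; j] (fun k => if k == i then A else B).
  rewrite /= inE ij => /(_ isT); rewrite big_cons big_seq1 eqxx eq_sym (negbTE ij).
  move=> <-; last by move=> k; case: ifP.
  congr (P' _); apply/seteqP; split => [w [Aw Bw] k /=|w H].
    by rewrite !inE => /orP[] /eqP ->; rewrite ?eqxx// eq_sym (negbTE ij).
  split; first by have /= := H i; rewrite !inE !eqxx; exact.
  by have /= := H j; rewrite !inE !eqxx orbT eq_sym (negbTE ij); exact.
have S2 : (\sum_(i < N) Z i) \in Lfun P' 2%:E by exact: Lfun2_sum.
have S1 := Lfun_subset12 (fin_num_measure P' _ measurableT) S2.
have avgE : mc_average Z N = N%:R^-1 \o* (\sum_(i < N) Z i).
  by apply/funext => w; rewrite /mc_average/= fct_sumE mulrC.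
rewrite avgE expectation_sqrB_cst; last by rewrite Lfun_scale// ler1n.
rewrite varianceZ// variance_sum_uncorrelated// expectationZl//.
have N0' : N%:R != 0 :> R by rewrite pnatr_eq0 -lt0n.
have ES : ('E_P'[\sum_(i < N) Z i] = (N%:R * fine 'E_P[X])%:E)%E.
  (* [expectation_sum] ranges over a list of variables, so the sum is first reindexed by the list of
     the [Z i]. *)
  rewrite -(big_mkord xpredT Z) -(big_map Z xpredT id) expectation_sum.
    rewrite big_map big_mkord (eq_bigr (fun=> (fine 'E_P[X])%:E)).
      by rewrite sumEFin sumr_const card_ord mulr_natl.
    by move=> i _; rewrite EZ fineK// -(EZ i) expectation_fin_num.
  by move=> _ /mapP[i _ ->].
have SV : (\sum_(i < N) 'V_P'[Z i] = (N%:R * fine 'V_P[X])%:E)%E.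
  rewrite (eq_bigr (fun=> (fine 'V_P[X])%:E)) => [|i _].
    by rewrite sumEFin sumr_const card_ord mulr_natl.
  by rewrite VZ fineK// variance_fin_num.
rewrite ES SV -(fineK (variance_fin_num X2)) -!EFinM -!EFinD /=.
by congr (_%:E); field.
Qed.

(** * Choice of the parameters and the resulting cost *)

Theorem theorem5 (R : realType) (m : nat)
  (f : R -> 'rV[R]_m -> 'rV[R]_m) (theta : R) (xi0 : 'rV[R]_m)
  (phi : 'rV[R]_m -> R) (S : R)
  (phi_diff : forall x, differentiable phi x)
  (phi_growth : polynomial_growth phi)
  (S_gt0 : 0 < S)
  (sigma0 h0 T0 : R) (sigma0_gt0 : 0 < sigma0) (h0_gt0 : 0 < h0)
  (T0_gt0 : 0 < T0)
  (* sensitivity of the ODE *)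
  (pi' : R)
  (pi'E : invariant_sensitivity (fun th => physical_measure (f th)) phi theta pi')
  (* sensitivity of the SDE *)
  (Pi' : R -> R)
  (Pi'E : forall sigma : R, 0 < sigma <= sigma0 ->
    invariant_sensitivity (fun th => sde_invariant (f th) sigma) phi theta
      (Pi' sigma))
  (* the SDE started from xi0, and the sensitivity of E[phi(X_T)] *)
  (d : measure_display) (Omega : measurableType d) (P : probability Omega R)
  (W : R -> Omega -> 'rV[R]_m) (W_bm : brownian_motion P W)
  (X : R -> R -> R -> Omega -> 'rV[R]_m)
  (X_sol : forall sigma : R, 0 < sigma <= sigma0 ->
    \forall th \near theta,
      {ae P, forall w, X th sigma 0 w = xi0} /\
      sde_solution P (f th) sigma W (X th sigma))
  (dF : R -> R -> R)
  (dFE : forall sigma T : R, 0 < sigma <= sigma0 -> T0 <= T ->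
    (\forall th \near theta, (fun w => phi (X th sigma T w)) \in Lfun P 1%:E) /\
    is_derive theta 1
      (fun th => fine 'E_P[(fun w => phi (X th sigma T w))]) (dF sigma T))
  (* the numerical paths, and the estimator computed from one path *)
  (nsteps : R -> R -> R -> Omega -> nat)
  (grid : R -> R -> R -> Omega -> nat -> R)
  (Yhat yhat : R -> R -> R -> Omega -> nat -> 'rV[R]_m)
  (grid_ok : forall sigma T h : R, admissible sigma0 T0 h0 sigma T h -> forall w,
    [/\ grid sigma T h w 0%N = 0,
        forall k, (k < nsteps sigma T h w)%N ->
          grid sigma T h w k < grid sigma T h w k.+1,
        grid sigma T h w (nsteps sigma T h w) = T,
        Yhat sigma T h w 0%N = xi0 &
        yhat sigma T h w 0%N = 0])
  (dFbreve : R -> R -> R -> Omega -> R)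
  (dFbreveE : forall sigma T h : R, admissible sigma0 T0 h0 sigma T h ->
    dFbreve sigma T h =
      pathwise_estimator phi S sigma W (nsteps sigma T h) (grid sigma T h)
        (Yhat sigma T h) (yhat sigma T h) /\
    dFbreve sigma T h \in Lfun P 2%:E)
  (* independent copies of the estimator *)
  (d' : measure_display) (Omega' : measurableType d')
  (P' : probability Omega' R)
  (Z : R -> R -> R -> nat -> Omega' -> R)
  (Z_iid : forall sigma T h : R, admissible sigma0 T0 h0 sigma T h -> iid_copies P (dFbreve sigma T h) P' (Z sigma T h))
  (c1 c2 c3 c4 clambda : R) (c1_gt0 : 0 < c1) (c2_gt0 : 0 < c2)
  (c3_gt0 : 0 < c3) (c4_gt0 : 0 < c4) (clambda_gt0 : 0 < clambda)
  (equilibrium : forall sigma T : R, 0 < sigma <= sigma0 -> T0 <= T ->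
    `|dF sigma T - Pi' sigma| <= c2 * expR (- (clambda * sigma ^+ 2 * T)))
  (weak_SDE_ODE : forall sigma : R, 0 < sigma <= sigma0 ->
    `|Pi' sigma - pi'| <= c3 * sigma)
  (variance_bound : forall sigma T h : R, admissible sigma0 T0 h0 sigma T h ->
    ('V_P[dFbreve sigma T h] <= (c4 * T / sigma ^+ 2)%:E)%E)
  (weak_error : forall sigma T h : R, admissible sigma0 T0 h0 sigma T h ->
    `|fine 'E_P[dFbreve sigma T h] - dF sigma T| <= c1 * h) :
  exists C K eps0 : R,
    [/\ 0 < C, 0 < K, 0 < eps0, eps0 < 1 &
      forall eps : R, 0 < eps < eps0 ->
        (ereal_inf [set x : \bar R | exists (sigma T h : R) (N : nat),
            [/\ admissible sigma0 T0 h0 sigma T h, (1 <= N)%N,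
                'E_P'[fun w => ((mc_average (Z sigma T h) N w - pi') ^+ 2)%R]
                  <= (C * eps ^+ 2)%:E &
                x = (N%:R * T / h)%:E]]
         <= (K * eps ^- 9 * `|ln eps| ^+ 2)%:E)%E].
Proof.
(* In [C], [c4] pays for the variance and the square for the squared bias. In [K], the 2 pays for
   rounding up N, and [clambda ^+ 2] comes from T^2. *)
exists (c4 + (c1 + c2 + c3) ^+ 2), (2 / clambda ^+ 2).
(* The first two bounds make sigma = h = eps admissible, [expR (-1)] gives |ln eps| > 1, and the
   last forces T >= T0 + 1, thus both T >= T0 and T >= 1. *)
exists (Num.min (Num.min sigma0 h0)
  (Num.min (expR (-1)) (1 + clambda * (T0 + 1))^-1)).
have q_gt0 : 0 < 1 + clambda * (T0 + 1).
  by rewrite addr_gt0// mulr_gt0// addr_gt0.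
split.
- by rewrite addr_gt0// exprn_gt0// !addr_gt0.
- by rewrite divr_gt0// exprn_gt0.
- by rewrite !lt_min sigma0_gt0 h0_gt0 expR_gt0 invr_gt0 q_gt0.
- by rewrite !gt_min expR_lt1 ltrN10 orbT.
move=> eps /andP[e0]; rewrite !lt_min => /andP[/andP[es eh] /andP[eexp eq_]].
have eq1 : eps * (1 + clambda * (T0 + 1)) < 1 by rewrite -ltr_pdivlMr// div1r.
set L := `|ln eps|.
have lneps : ln eps < -1 by rewrite -[ltRHS]expRK ltr_ln ?posrE ?expR_gt0.
have LE : L = - ln eps by rewrite /L ltr0_norm//; lra.
have L1 : 1 <= L by rewrite LE; lra.
have expL : expR (- L) = eps by rewrite LE opprK lnK.
have e1 : eps < 1 by apply: lt_trans eexp _; rewrite expR_lt1 ltrN10.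
have ce2 : 0 < clambda * eps ^+ 2 by rewrite mulr_gt0// exprn_gt0.
pose T := L / (clambda * eps ^+ 2).
have T_ge : T0 + 1 <= T.
  rewrite ler_pdivlMr//; apply: le_trans L1.
  have : eps ^+ 2 * (clambda * (T0 + 1)) <= eps * (clambda * (T0 + 1)).
    rewrite ler_pM2r; last by rewrite mulr_gt0// addr_gt0.
    by rewrite expr2 ger_pMr// ltW.
  lra.
have T_gt0 : 0 < T by lra.
have e4 : 0 < eps ^+ 4 by rewrite exprn_gt0.
(* The least integer above T / eps^4: [N_gt] serves the variance, [N_le] the cost. *)
pose N := (Num.truncn (T / eps ^+ 4)).+1.
have /andP[N_le N_gt] : (N.-1)%:R <= T / eps ^+ 4 < N%:R.
  by apply: truncn_itv; rewrite divr_ge0// ltW.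
have N0 : 0 < N%:R :> R by rewrite ltr0n.
have adm : admissible sigma0 T0 h0 eps T eps.
  by split; rewrite ?e0 ?ltW//; lra.
have [_ dFb2] := dFbreveE _ _ _ adm.
(* The infimum is at most the cost of this one feasible choice. *)
apply: (@le_trans _ _ (N%:R * T / eps)%:E).
  apply: ereal_inf_lbound; exists eps, T, eps, N; split => //.
  rewrite (expectation_mc_average_sqrB _ dFb2 (Z_iid _ _ _ adm))//.
  have := variance_bound _ _ _ adm; rewrite -(fineK (variance_fin_num dFb2)).
  rewrite -EFinM -EFinD 2!lee_fin => V_le; rewrite mulrDl lerD//.
    rewrite ler_pdivrMl//; apply: le_trans V_le _.
    move: N_gt; rewrite ltr_pdivrMr// => /ltW N_gt.
    rewrite ler_pdivrMr ?exprn_gt0//.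
    have -> : N%:R * (c4 * eps ^+ 2) * eps ^+ 2 = c4 * (N%:R * eps ^+ 4).
      by ring.
    by rewrite ler_pM2l.
  have esig : 0 < eps <= sigma0 by rewrite e0 ltW.
  have T0T : T0 <= T by lra.
  have := equilibrium _ _ esig T0T.
  have -> : clambda * eps ^+ 2 * T = L by rewrite /T; field; rewrite !gt_eqF.
  rewrite expL => b2.
  have b1 := weak_error _ _ _ adm; have b3 := weak_SDE_ODE _ esig.
  set EF := fine _ in b1 *.
  rewrite -exprMn -real_normK ?num_real// ler_sqr ?nnegrE//; last first.
    by rewrite mulr_ge0// ltW// !addr_gt0.
  (* The bias splits into the errors of time discretization, finite horizon and added noise, bounded
     by [c1], [c2] and [c3] times eps. *)
  have -> : EF - pi' = (EF - dF eps T) + (dF eps T - Pi' eps) + (Pi' eps - pi').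
    by ring.
  apply: le_trans (ler_normD _ _) _; rewrite 2!mulrDl lerD//.
  by apply: le_trans (ler_normD _ _) _; rewrite lerD.
rewrite lee_fin.
(* The extra 1 from rounding is absorbed because eps^4 <= 1 <= T. *)
have N_le2 : N%:R <= 2 * (T / eps ^+ 4).
  have : 1 <= T / eps ^+ 4.
    rewrite ler_pdivlMr// mul1r; apply: (@le_trans _ _ 1); last by lra.
    by rewrite exprn_ile1// ltW.
  by rewrite /N -natr1; move: N_le; rewrite /N /=; lra.
have -> : 2 / clambda ^+ 2 * eps ^- 9 * L ^+ 2 = 2 * (T / eps ^+ 4) * T / eps.
  by rewrite /T; field; rewrite !gt_eqF.
by rewrite ler_pM2r ?invr_gt0// ler_pM2r.
Qed.
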